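(* Let $\ell\ge 4$, $s\ge 0$ and $r\ge 2$ be integers and let $k=\lfloor (\ell-2)/2\rfloor$. Then for all sufficiently large $n$ the following hold. (a) If $\ell$ is even, then $\mathrm{ex}_r(n,B(\ell,s))=e_r(H(k,n))$, and $H(k,n)$ is the unique extremal graph. (b) If $\ell$ is odd and either $\ell\ge 7$, or $\ell=5$ and $s=0$, then $\mathrm{ex}_r(n,B(\ell,s))=e_r(H^*(k,n))$, and $H^*(k,n)$ is the unique extremal graph. (c) If $\ell=5$ and $s>0$, then $\mathrm{ex}_r(n,B(\ell,s))=e_r(F_n)$, and $F_n$ is the unique extremal graph.
   Context: For a graph $G$ with degree sequence $d_1,\dots,d_n$ and a positive integer $r$, $e_r(G)=\sum_{i=1}^n d_i^r$. For a graph $F$, $\mathrm{ex}_r(n,F)$ is the maximum of $e_r(G)$ over all $n$-vertex graphs $G$ containing no copy of $F$ (as a subgraph); an extremal graph is an $n$-vertex $F$-free graph attaining this maximum. The broom $B(\ell,s)$ is the graph obtained from a path $P_\ell$ on $\ell$ vertices by adding $s$ new vertices, each joined only to a penultimate vertex of the path (a neighbor of an endpoint). $H(k,n)$ is the $n$-vertex graph obtained from the complete bipartite graph $K_{k,n-k}$ by adding all edges inside the part of size $k$ (so $k$ vertices have degree $n-1$ and $n-k$ vertices have degree $k$). $H^*(k,n)$ is obtained from $H(k,n)$ by adding one edge (necessarily between two vertices of the part of size $n-k$). $S_n$ is the star on $n$ vertices, and $F_n$ is the graph obtained from $S_n$ by adding $\lfloor (n-1)/2\rfloor$ pairwise disjoint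 edges among the leaves. *)

(* Defs.v *)
From mathcomp Require Import all_boot all_order fingroup perm.
Set Implicit Arguments. Unset Strict Implicit. Unset Printing Implicit Defensive.

Definition graph (n : nat) := {ffun 'I_n * 'I_n -> bool}.

Definition adj n (g : graph n) (x y : 'I_n) : bool := g (x, y).

Definition simple n (g : graph n) : bool :=
  [forall x, ~~ adj g x x] && [forall x, forall y, adj g x y == adj g y x].

Definition deg n (g : graph n) (x : 'I_n) : nat := #|[set y | adj g x y]|.

Definition e_r (r : nat) n (g : graph n) : nat := \sum_(x : 'I_n) deg g x ^ r.
Arguments e_r r {n} g.

Definition contains m n (F : graph m) (G : graph n) : bool :=
  [exists f : {ffun 'I_m -> 'I_n},
     injectiveb f && [forall i, forall j, adj F i j ==> adj G (f i) (f j)]].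

Definition Ffree m n (F : graph m) (G : graph n) : bool := ~~ contains F G.

Definition ex_r (n r : nat) m (F : graph m) : nat :=
  \max_(g : graph n | simple g && Ffree F g) e_r r g.
Arguments ex_r n r {m} F.

Definition extremal (n r : nat) m (F : graph m) (G : graph n) : Prop :=
  [/\ simple G, Ffree F G & e_r r G = ex_r n r F].
Arguments extremal n r {m} F G.

Definition isomorphic n (G H : graph n) : Prop :=
  exists s : {perm 'I_n}, forall x y, adj G (s x) (s y) = adj H x y.

(* Broom B(l,s) on vertices 0..l+s-1: path 0-1-...-(l-1), and the vertices
   l..l+s-1 joined to vertex 1 (the penultimate vertex next to endpoint 0). *)
Definition broom (l s : nat) : graph (l + s) :=
  [ffun p : 'I_(l + s) * 'I_(l + s) =>
     let i := val p.1 in let j := val p.2 in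
     [&& i < l, j < l & (i.+1 == j) || (j.+1 == i)]
     || ((i == 1) && (l <= j)) || ((j == 1) && (l <= i))].

Definition Hkn (k n : nat) : graph n :=
  [ffun p : 'I_n * 'I_n =>
     (val p.1 != val p.2) && ((val p.1 < k) || (val p.2 < k))].

Definition Hstar (k n : nat) : graph n :=
  [ffun p : 'I_n * 'I_n =>
     Hkn k n p
     || ((val p.1 == k) && (val p.2 == k.+1))
     || ((val p.1 == k.+1) && (val p.2 == k))].

(* F_n: star with center 0 plus the floor((n-1)/2) disjoint edges
   {1,2},{3,4},... among the leaves. *)
Definition Fn (n : nat) : graph n :=
  [ffun p : 'I_n * 'I_n =>
     let i := val p.1 in let j := val p.2 in
     (i != j) && [|| i == 0, j == 0, odd i && (j == i.+1) | odd j && (i == j.+1)]].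

Definition unique_extremal (n r : nat) m (F : graph m) (H : graph n) : Prop :=
  [/\ extremal n r F H, ex_r n r F = e_r r H &
      forall G : graph n, extremal n r F G -> isomorphic G H].
Arguments unique_extremal n r {m} F H.

(* Main.v *)
Require Import Defs.
From mathcomp Require Import all_boot all_order fingroup perm.
From mathcomp Require Import zify.
Set Implicit Arguments. Unset Strict Implicit. Unset Printing Implicit Defensive.

(* Put l = 2k+2 or 2k+3.  If G is broom-free and e_r(G) is at least that of the
   candidate, then G has exactly k vertices A of degree close to n: brooms being
   trees, G has O(n) edges, so only boundedly many vertices L have degree >= n/q,
   and all but boundedly many vertices have at most k neighbours in L (otherwise
   a large K_{k+1,m} appears); so the degrees over L sum to at most kn + O(1),
   whereas their squares sum to about kn^2.
   A path outside A that starts in the common neighbourhood W of A extends by a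
   zigzag between W and A to a broom, so no path on three vertices outside A starts in W,
   and the edges of G inside W form a matching (empty for even l, at most a single
   edge for l = 2k+3 unless k = 1 and s > 0).
   Each vertex of U, those outside A and W, costs about n^(r-1) through the degrees
   of A and brings in much less because |U| is a small fraction of n.  So U is
   empty, and G is k dominating vertices plus a matching outside them. *)

(** * Neighbourhoods and embeddings of brooms *)

Definition nb n (g : graph n) (x : 'I_n) : {set 'I_n} := [set y | adj g x y].

Lemma in_nb n (g : graph n) x y : (y \in nb g x) = adj g x y.
Proof. by rewrite inE. Qed.

Lemma adjxx n (g : graph n) x : simple g -> adj g x x = false.
Proof. by case/andP=> /forallP/(_ x)/negbTE. Qed.

Lemma adjC n (g : graph n) x y : simple g -> adj g x y = adj g y x.
Proof. by case/andP=> _ /forallP/(_ x)/forallP/(_ y)/eqP. Qed.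

Lemma card_mem_seq n (p : seq 'I_n) : #|[set z in p]| <= size p.
Proof. by rewrite cardsE; exact: card_size. Qed.

Lemma card_setD_seq n (W : {set 'I_n}) (p : seq 'I_n) :
  #|W| - size p <= #|W :\: [set z in p]|.
Proof.
rewrite cardsD leq_sub2l // (leq_trans _ (card_mem_seq p)) //.
exact/subset_leq_card/subsetIr.
Qed.

(** Here [x] is the endpoint and [y] the centre. The path may be longer than needed: its first [l]
    vertices are the spine, and choosing leaves off the whole path keeps them off the spine. *)
Lemma broom_of_path l s n (g : graph n) (x y : 'I_n) (p : seq 'I_n) :
  simple g -> 1 < l <= (size p).+2 -> path (adj g) x (y :: p) ->
  uniq (x :: y :: p) -> s <= #|nb g y :\: [set z in x :: y :: p]| ->
  contains (broom l s) g.
Proof.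
move=> sg /andP[l1 lp] pathp; set P := x :: y :: p; set L := _ :\: _ => uP sL.
pose f := [ffun i : 'I_(l + s) =>
  if i < l then nth x P i else nth x (enum L) (i - l)].
have PL i : l <= i < l + s -> nth x (enum L) (i - l) \in L.
  move=> il; rewrite -mem_enum mem_nth // -cardE; apply: leq_trans sL; lia.
have Pin i : i < l -> nth x P i \in P by move=> il; rewrite mem_nth //=; lia.
have LnP z : z \in L -> (z \notin P) * adj g y z.
  by rewrite in_setD in_nb in_set => /andP[-> ->].
have key (i j : 'I_(l + s)) : i < l -> l <= j -> f i <> f j.
  move=> il jl; rewrite !ffunE il ltnNge jl /= => e.
  have := PL j; rewrite jl ltn_ord => /(_ isT) /LnP[].
  by rewrite -e Pin.
have stp i : i.+1 < l -> adj g (nth x P i) (nth x P i.+1).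
  by move=> il; move/(pathP x): pathp; apply=> /=; lia.
apply/existsP; exists f; apply/andP; split.
  apply/injectiveP => i j.
  case: (ltnP i l) => il; case: (ltnP j l) => jl.
  - rewrite !ffunE il jl => /eqP; rewrite nth_uniq //=; try lia.
    by move/eqP/val_inj.
  - by move/(key i j il jl).
  - by move/esym/(key j i jl il).
  - rewrite !ffunE !ltnNge il jl /= => /eqP; rewrite nth_uniq ?enum_uniq -?cardE //.
    + by move/eqP=> e; apply/val_inj => /=; lia.
    + by apply: leq_trans sL; have := ltn_ord i; lia.
    + by apply: leq_trans sL; have := ltn_ord j; lia.
apply/forallP=> i; apply/forallP=> j; apply/implyP; rewrite /adj ffunE /=.
have leaf (a b : 'I_(l + s)) : val a == 1 -> l <= b -> adj g (f a) (f b).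
  move=> /eqP /= a1 bl; rewrite !ffunE a1 l1 ltnNge bl /=.
  by have := PL b; rewrite bl ltn_ord => /(_ isT) /LnP[].
rewrite -!/(adj g _ _) => /orP[/orP[/and3P[il jl ij]|/andP[]]|/andP[]].
- rewrite !ffunE il jl; case/orP: ij => /eqP ij; last rewrite adjC //.
    by rewrite -ij; apply: stp; rewrite ij.
  by rewrite -ij; apply: stp; rewrite ij.
- exact: leaf.
- by move=> *; rewrite adjC //; apply: leaf.
Qed.

(* Prepends to q, for each hub t in ts, a fresh vertex of W followed by t. *)
Lemma zigzag n (g : graph n) (W : {set 'I_n}) (ts : seq 'I_n) (x : 'I_n) q :
  simple g -> {in ts & W, forall t w, adj g t w} -> uniq ts ->
  {in ts, forall t, t \notin x :: q} -> x \in W ->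
  path (adj g) x q -> uniq (x :: q) -> (size q).+1 + (size ts).*2 <= #|W| ->
  exists z p, [/\ z \in W, path (adj g) z p /\ uniq (z :: p),
    size p = size q + (size ts).*2,
    forall v, v \in z :: p -> [|| v \in ts, v \in W | v \in x :: q] &
    forall t, ohead ts = Some t -> ohead p = Some t].
Proof.
move=> sg + + + xW pq uq; elim: ts => [|t ts IH] tW ut tq szW.
  exists x, q; split=> //; first by rewrite /= addn0.
  by move=> z ->; rewrite !orbT.
have [||||z [p [zW [pp up] sp sub _]]] := IH.
- by move=> a w ats wW; apply: tW => //; rewrite inE ats orbT.
- by case/andP: ut.
- by move=> a ats; apply: tq; rewrite inE ats orbT.
- by move: szW => /=; lia.
have tnW : t \notin W.
  by apply/negP => /(tW t t (mem_head _ _)); rewrite adjxx.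
have tnp : t \notin z :: p.
  apply/negP => /sub; rewrite !inE (negbTE tnW) /=; case/andP: ut => /negbTE -> _ /=.
  by have := tq t (mem_head _ _); rewrite inE => /negbTE ->.
have [o oW onp] : exists2 o, o \in W & o \notin z :: p.
  have: 0 < #|W :\: [set v in z :: p]|.
    apply: leq_trans (card_setD_seq _ _); rewrite subn_gt0.
    by apply: leq_trans szW; rewrite /= sp; lia.
  by case/card_gt0P=> o; rewrite !inE => /andP[? ?]; exists o; rewrite // inE.
exists o, (t :: z :: p); split=> //.
- split; first by rewrite /= adjC // !tW ?mem_head //= pp.
  rewrite cons_uniq inE negb_or onp andbT; rewrite cons_uniq tnp up !andbT.
  by apply: contraNneq tnW => <-.
- by rewrite /= sp; lia.
move=> v; rewrite inE => /predU1P[->|]; first by rewrite !inE oW orbT.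
rewrite inE => /predU1P[->|/sub]; first by rewrite !inE eqxx.
by rewrite !inE => /or3P[]->; rewrite ?orbT.
Qed.

Lemma broom_zigzag l s n (g : graph n) (W : {set 'I_n}) (ts : seq 'I_n) (x : 'I_n) q :
  simple g -> {in ts & W, forall t w, adj g t w} -> uniq ts -> 0 < size ts ->
  {in ts, forall t, t \notin x :: q} -> x \in W ->
  path (adj g) x q -> uniq (x :: q) ->
  1 < l <= (size q).+1 + (size ts).*2 ->
  (size q).+1 + (size ts).*2 + s <= #|W| -> contains (broom l s) g.
Proof.
move=> sg tW ut ts0 tq xW pq uq lb szW.
have [|z [p [zW [pp up] sp _ hp]]] := zigzag sg tW ut tq xW pq uq; first lia.
case: ts ts0 tW {ut tq} lb szW sp hp => // t ts _ tW lb szW sp /(_ t erefl).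
case: p pp up sp => [|? p] // pp up sp [tE]; rewrite {}tE in pp up sp.
apply: broom_of_path pp up _ => //; first by move: lb sp => /=; lia.
apply: leq_trans (_ : #|W :\: [set v in [:: z, t & p]]| <= _).
  apply: leq_trans (card_setD_seq _ _); apply: leq_trans (leq_sub2r _ szW).
  by move: sp => /=; lia.
apply/subset_leq_card/setSD/subsetP => w wW.
by rewrite in_nb tW ?mem_head.
Qed.

(** Start from one vertex of [X] and zigzag through [k.+1] vertices of [T]: the path has
    [1 + 2 * k.+1], that is [2k + 3], vertices. *)
Lemma broom_of_bip l s k n (g : graph n) (T X : {set 'I_n}) :
  simple g -> 1 < l <= k.*2 + 3 -> k < #|T| -> k.*2 + 3 + s <= #|X| ->
  {in T & X, forall t x, adj g t x} -> contains (broom l s) g.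
Proof.
move=> sg lk kT sX tX.
have [x xX] : exists x, x \in X by apply/card_gt0P; lia.
have szT : size (take k.+1 (enum T)) = k.+1 by rewrite size_takel // -cardE.
have inT t : t \in take k.+1 (enum T) -> t \in T by move/mem_take; rewrite mem_enum.
apply: (@broom_zigzag l s n g X (take k.+1 (enum T)) x [::]) => //.
- by move=> t w /inT tT; apply: tX.
- by rewrite take_uniq ?enum_uniq.
- by rewrite szT.
- move=> t /inT tT; rewrite inE; apply: contraTneq xX => <-.
  by apply/negP => /(tX t t tT); rewrite adjxx.
- by rewrite szT /=; lia.
- by apply: leq_trans sX; rewrite szT /=; lia.
Qed.

(** * Broom-free graphs have linearly many edges *)

(** Greedy: as long as the path has fewer than [d] vertices, its front vertex has a neighbour in [S]
    off the path. *)
Lemma long_path n (g : graph n) (S : {set 'I_n}) d :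
  simple g -> {in S, forall v, d <= #|nb g v :&: S|} -> S != set0 ->
  forall i, i < d -> exists x p,
    [/\ all [in S] (x :: p), size p = i, path (adj g) x p & uniq (x :: p)].
Proof.
move=> sg dS /set0Pn[x xS]; elim=> [|i IH] id.
  by exists x, [::]; rewrite /= xS.
have [|y [p [pS sp pp up]]] := IH; first lia.
have yS : y \in S by case/andP: pS.
have [z] : exists z, z \in (nb g y :&: S) :\: [set v in y :: p].
  apply/card_gt0P; apply: leq_trans (card_setD_seq _ _).
  by rewrite subn_gt0; apply: leq_trans (dS y yS); rewrite /= sp.
rewrite in_setD in_setI in_nb in_set => /and3P[zp yz zS].
exists z, (y :: p); split; first by rewrite /= zS.
- by rewrite /= sp.
- by rewrite /= adjC // yz.
- by rewrite cons_uniq up zp.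
Qed.

(** Otherwise a greedy path on [l] vertices exists inside [S], and its second vertex keeps at least
    [s] neighbours after the [l] path vertices are discarded. *)
Lemma degenerate l s n (g : graph n) (S : {set 'I_n}) :
  1 < l -> simple g -> Ffree (broom l s) g -> S != set0 ->
  exists2 v, v \in S & #|nb g v :&: S| < l + s.
Proof.
move=> l1 sg fr S0; apply/exists_inP; apply: contraNT fr => /exists_inPn H.
have {}H : {in S, forall v, l + s <= #|nb g v :&: S|}.
  by move=> v vS; rewrite leqNgt; apply: H.
have [|x [[|y p] [pS sp pp up]]] := @long_path _ _ _ _ sg H S0 l.-1; first lia.
  by rewrite /= in sp; lia.
have yS : y \in S by case/and3P: pS.
apply: broom_of_path pp up _ => //; first by move: sp => /=; lia.
apply: leq_trans (_ : #|(nb g y :&: S) :\: [set v in [:: x, y & p]]| <= _).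
  apply: leq_trans (card_setD_seq _ _); apply: leq_trans (leq_sub2r _ (H y yS)).
  by move: sp => /=; lia.
by apply/subset_leq_card/setSD/subsetIl.
Qed.

Lemma card_nbI n (g : graph n) x (S : {set 'I_n}) :
  #|nb g x :&: S| = \sum_(y in S) adj g x y.
Proof.
rewrite -sum1_card big_mkcond [RHS]big_mkcond; apply: eq_bigr => y _.
by rewrite !inE andbC; case: (y \in S); case: (adj g x y).
Qed.

Lemma degE n (g : graph n) x : deg g x = #|nb g x|. Proof. by []. Qed.

Lemma sum_nbIC n (g : graph n) (S T : {set 'I_n}) : simple g ->
  \sum_(x in S) #|nb g x :&: T| = \sum_(y in T) #|nb g y :&: S|.
Proof.
move=> sg; under eq_bigr do rewrite card_nbI.
rewrite exchange_big; apply: eq_bigr => y _; rewrite card_nbI.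
by apply: eq_bigr => x _; rewrite adjC.
Qed.

(** Peel off a vertex given by [degenerate]. Each removal lowers the degree sum by twice the degree
    of that vertex in [S]. *)
Lemma sum_deg_in l s n (g : graph n) (S : {set 'I_n}) :
  1 < l -> simple g -> Ffree (broom l s) g ->
  \sum_(x in S) #|nb g x :&: S| <= (l + s).*2 * #|S|.
Proof.
move=> l1 sg fr; move: {2}#|S| (erefl #|S|) => c; elim: c S => [|c IH] S cS.
  by rewrite (cards0_eq cS) big_set0.
have [|v vS dv] := @degenerate l s n g S l1 sg fr.
  by rewrite -card_gt0 cS.
have cS' : #|S :\ v| = c by move: cS; rewrite (cardsD1 v) vS; case.
rewrite (big_setD1 v) //= (eq_bigr (fun x => #|nb g x :&: (S :\ v)| + adj g x v)).
  rewrite big_split /=.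
  have -> : \sum_(x in S :\ v) adj g x v = #|nb g v :&: (S :\ v)|.
    by rewrite card_nbI; apply: eq_bigr => x _; rewrite adjC.
  have dv' := leq_trans (subset_leq_card (setIS (nb g v) (subsetDl S [set v]))) (ltnW dv).
  apply: leq_trans (leq_add (ltnW dv) (leq_add (IH _ cS') dv')) _.
  by rewrite cS' cS mulnS; lia.
by move=> x _; rewrite !card_nbI (big_setD1 v) //= addnC.
Qed.

(** * Common neighbourhoods and the [k] hubs *)

Definition cnb n (g : graph n) (A : {set 'I_n}) : {set 'I_n} :=
  [set w | [forall a in A, adj g a w]].

Lemma cnbP n (g : graph n) (A : {set 'I_n}) a w :
  a \in A -> w \in cnb g A -> adj g a w.
Proof. by move=> aA; rewrite inE => /forall_inP/(_ a aA). Qed.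

(** Union bound: a vertex outside [cnb g A] is a non-neighbour of some member of [A]. *)
Lemma card_missed n (g : graph n) (A S : {set 'I_n}) :
  [disjoint S & cnb g A] -> #|S| <= \sum_(a in A) #|S :\: nb g a|.
Proof.
move=> dS.
have E a : #|S :\: nb g a| = \sum_(w in S) ~~ adj g a w.
  rewrite -sum1_card big_mkcond [RHS]big_mkcond; apply: eq_bigr => w _.
  by rewrite !inE andbC; case: (w \in S); case: (adj g a w).
under eq_bigr do rewrite E; rewrite exchange_big -sum1_card.
apply: leq_sum => w wS; have := disjointFr dS wS.
rewrite inE => /negbT; rewrite negb_forall_in => /exists_inP[a aA aw].
by rewrite (bigD1 a) //= aw.
Qed.

Lemma deg_le n (g : graph n) x : deg g x <= n.
Proof. by rewrite -[X in _ <= X]card_ord max_card. Qed.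

Lemma card_cnb n (g : graph n) (A : {set 'I_n}) :
  n <= #|cnb g A| + \sum_(a in A) (n - deg g a).
Proof.
have := @card_missed n g A (~: cnb g A); rewrite disjoints_subset.
move=> /(_ (subxx _)) le; rewrite -[X in X <= _]card_ord -(cardsC (cnb g A)) leq_add2l.
apply: leq_trans le _; apply: leq_sum => a _.
rewrite -[X in X - _]card_ord -(cardsC (nb g a)) addKn.
by apply/subset_leq_card; rewrite setDE subsetIr.
Qed.

(** Pigeonhole on the trace [nb g v :&: L]: if [2k + 3 + s] vertices share a trace with more than
    [k] elements, they span with it a complete bipartite graph containing the broom. *)
Lemma card_many_nbrs l s k n (g : graph n) (L : {set 'I_n}) :
  simple g -> 1 < l <= k.*2 + 3 -> Ffree (broom l s) g ->
  #|[set v | k < #|nb g v :&: L|]| <= 2 ^ #|L| * (k.*2 + 3 + s).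
Proof.
move=> sg lk fr; set B := [set v | _].
rewrite -sum1_card (partition_big (fun v => nb g v :&: L) [in powerset L]) /=; last first.
  by move=> v _; rewrite powersetE subsetIr.
rewrite -card_powerset -sum_nat_const; apply: leq_sum => T _.
rewrite sum1_card; have [/ltnW//|big] := ltnP #|[pred v in B | nb g v :&: L == T]| (k.*2 + 3 + s).
case/negP: fr.
have [v] : exists v, v \in [pred v in B | nb g v :&: L == T].
  by apply/card_gt0P/(leq_trans _ big); lia.
rewrite !inE => /andP[kv /eqP vT].
apply: (@broom_of_bip l s k n g T [set v in B | nb g v :&: L == T]) => //.
- by rewrite -vT.
- by rewrite cardsE.
move=> t w tT; rewrite !inE => /andP[_ /eqP wT].
by move: tT; rewrite -wT inE in_nb adjC // => /andP[].
Qed.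

(** Double counting of the pairs between [L] and all vertices. Those with more than [k] neighbours
    in [L] contribute at most [#|L|] each, and [card_many_nbrs] bounds their number. *)
Lemma sum_deg_large l s k n (g : graph n) (L : {set 'I_n}) :
  simple g -> 1 < l <= k.*2 + 3 -> Ffree (broom l s) g ->
  \sum_(v in L) deg g v <= k * n + 2 ^ #|L| * (k.*2 + 3 + s) * #|L|.
Proof.
move=> sg lk fr; have bB := card_many_nbrs L sg lk fr; set B := [set v | _] in bB.
have -> : \sum_(v in L) deg g v = \sum_(v in setT) #|nb g v :&: L|.
  by rewrite -sum_nbIC //; apply: eq_bigr => v _; rewrite setIT.
apply: leq_trans (_ : \sum_(v in [set: 'I_n]) (k + (v \in B) * #|L|) <= _).
  apply: leq_sum => v _; have [/leq_trans-> //|kv] := leqP #|nb g v :&: L| k.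
    by rewrite leq_addr.
  by rewrite inE kv mul1n (leq_trans _ (leq_addl _ _)) // subset_leq_card ?subsetIr.
rewrite big_split /= sum_nat_const cardsT card_ord mulnC leq_add ?leqnn //.
rewrite -big_distrl /= leq_mul //.
have -> : \sum_(v in [set: 'I_n]) (v \in B) = #|B|.
  rewrite -sum1_card [RHS]big_mkcond; apply: eq_big => v; first by rewrite in_setT.
  by case: (v \in B).
exact: bB.
Qed.

(* P and a2 stand for the sums of d(n-d) and d^2 over L, X for the sum of d over the
   vertices of L with h(n-d) > n,
   b2 for the sum of d^2 outside L, S for the sum of all degrees, and A for the
   number of vertices with h(n-d) <= n. *)
Lemma hub_arith k h D n P a2 b2 X A c2 S :
  let q := 6 * h * D in
  0 < D -> 0 < h -> 12 * k < n -> q * (c2 + 2 * k) <= n -> 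
  k * (n - 1) ^ 2 <= a2 + b2 -> q * b2 <= n * S -> S <= D.*2 * n ->
  P + a2 <= n * (k * n + c2) -> n * X <= h * P ->
  a2 <= A * n ^ 2 + n * X -> k <= A.
Proof.
move=> q D0 h0 nk nq H1 H2 H3 H4 H5 H6; rewrite leqNgt; apply/negP => Ak.
have E1 : k * n ^ 2 <= a2 + b2 + 2 * k * n.
  apply: leq_trans (leq_add H1 (leqnn _)); case: n {nq H2 H3 H4 H5 H6 H1} nk => // n _.
  by rewrite subn1 /=; nia.
have E2 : q * b2 <= 2 * D * n ^ 2.
  have : n * S <= n * (D.*2 * n) by rewrite leq_mul2l H3 orbT.
  by clearbody q; lia.
have E3 : q * P <= 3 * D * n ^ 2.
  have : q * P + q * a2 <= q * (n * (k * n + c2)) by rewrite -mulnDr leq_mul2l H4 orbT.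
  have : q * (k * n ^ 2) <= q * (a2 + b2 + 2 * k * n) by rewrite leq_mul2l E1 orbT.
  have : n * (q * (c2 + 2 * k)) <= n * n by rewrite leq_mul2l nq orbT.
  have : n * n <= D * n ^ 2 by rewrite mulnn leq_pmull.
  by clearbody q; lia.
have E4 : q * X <= 3 * h * D * n.
  have n0 : 0 < n by lia.
  rewrite -(leq_pmul2l n0).
  have : q * (n * X) <= q * (h * P) by rewrite leq_mul2l H5 orbT.
  have : h * (q * P) <= h * (3 * D * n ^ 2) by rewrite leq_mul2l E3 orbT.
  by clearbody q; lia.
have E5 : q * (k * n ^ 2) <=
    q * (A * n ^ 2) + n * (3 * h * D * n) + 2 * D * n ^ 2 + q * (2 * k * n).
  have : n * (q * X) <= n * (3 * h * D * n) by rewrite leq_mul2l E4 orbT.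
  have : q * (k * n ^ 2) <= q * (a2 + b2 + 2 * k * n) by rewrite leq_mul2l E1 orbT.
  have : q * a2 <= q * (A * n ^ 2 + n * X) by rewrite leq_mul2l H6 orbT.
  by clearbody q; lia.
have E6 : q * (A * n ^ 2) + q * n ^ 2 <= q * (k * n ^ 2).
  by rewrite -mulnDr leq_mul2l addnC -mulSn leq_mul2r Ak !orbT.
have E7 : 2 * D * n ^ 2 <= 2 * h * D * n ^ 2.
  by rewrite !leq_mul2r leq_pmulr // ?orbT.
(* Here the factor 6 in [q] is spent: of the gap [6hDn^2] forced by [A < k], the term in [X] fills
   [3hDn^2], [b2] at most [2hDn^2], and the last term [12khDn], which is less than [hDn^2]. *)
have : (h * D * n) * (12 * k) < (h * D * n) * n by rewrite ltn_mul2l nk andbT !muln_gt0 h0 D0; lia.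
move: E5 E6 E7; rewrite /q; lia.
Qed.

Lemma sum_deg l s n (g : graph n) :
  1 < l -> simple g -> Ffree (broom l s) g ->
  \sum_x deg g x <= (l + s).*2 * n.
Proof.
move=> l1 sg fr; have := sum_deg_in [set: 'I_n] l1 sg fr.
rewrite cardsT card_ord; apply: leq_trans; rewrite [X in _ <= X]big_mkcond.
by apply: leq_sum => x _; rewrite in_setT setIT.
Qed.

(** [hub_arith] gives at least [k] hubs. Any [k.+1] hubs have total deficit at most [n / 2], because
    [h] is at least [2(k + 1)]; they would then have a large common neighbourhood and [broom_of_bip]
    would apply. *)
Lemma hubs l s k h : 1 < l <= k.*2 + 3 -> k.+1.*2 <= h ->
  exists N, forall n (g : graph n), N <= n -> simple g -> Ffree (broom l s) g ->
    k * (n - 1) ^ 2 <= \sum_x deg g x ^ 2 ->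
    exists A : {set 'I_n}, #|A| = k /\ {in A, forall a, h * (n - deg g a) <= n}.
Proof.
move=> lk kh; have l1 : 1 < l by case/andP: lk.
(* [D.*2 * n] bounds the degree sum, so at most [M] vertices have degree at least [n / q]. [c2] is
   the additive constant of [sum_deg_large] for such a set. *)
pose D := l + s; pose q := 6 * h * D; pose M := q * D.*2.
pose c2 := 2 ^ M * (k.*2 + 3 + s) * M.
exists ((12 * k).+1 + q * (c2 + 2 * k) + (k.*2 + 3 + s).*2) => n g nN sg fr S2.
have D0 : 0 < D by rewrite /D; lia.
have h0 : 0 < h by lia.
have n0 : 0 < n by lia.
have Sd := sum_deg l1 sg fr; rewrite -/D in Sd.
pose L := [set v | n <= q * deg g v].
pose A := [set v | h * (n - deg g v) <= n].
have ML : #|L| <= M.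
  rewrite -(leq_pmul2r n0) -sum_nat_const.
  apply: leq_trans (_ : \sum_(v in L) q * deg g v <= _).
    by apply: leq_sum => v; rewrite inE.
  rewrite /M -big_distrr /= -mulnA leq_mul2l; apply/orP; right; apply: leq_trans Sd.
  by rewrite [X in _ <= X](bigID [in L]) leq_addr.
have kA : k <= #|A|.
  apply: (@hub_arith k h D n (\sum_(v in L) deg g v * (n - deg g v))
    (\sum_(v in L) deg g v ^ 2) (\sum_(v | v \notin L) deg g v ^ 2)
    (\sum_(v | (v \in L) && (v \notin A)) deg g v) #|A| c2 (\sum_v deg g v)) => //.
  - by lia.
  - by rewrite -/q; lia.
  - by rewrite -(bigID [in L] predT (fun v => deg g v ^ 2)).
  - rewrite -/q !big_distrr /= [X in _ <= X](bigID [in L]) /=.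
    apply: leq_trans (leq_addl _ _); apply: leq_sum => v.
    rewrite inE -ltnNge => /ltnW qn; rewrite expnS expn1 mulnA leq_mul2r qn orbT //.
  - rewrite -big_split /= (eq_bigr (fun v => n * deg g v)); last first.
      move=> v _; rewrite expnS expn1 -mulnDr mulnC subnK //; exact: deg_le.
    rewrite -big_distrr leq_mul2l; apply/orP; right.
    apply: leq_trans (sum_deg_large L sg lk fr) _; rewrite leq_add2l.
    by rewrite /c2 !leq_mul // leq_pexp2l.
  - rewrite !big_distrr [X in _ <= X](bigID [in A]) /=.
    apply: leq_trans (leq_addl _ _); apply: leq_sum => v /andP[_].
    rewrite inE -ltnNge => /ltnW hn.
    by rewrite mulnA [h * _]mulnC -mulnA mulnC leq_mul2l hn orbT.
  - rewrite [X in X <= _](bigID [in A]) /= leq_add //.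
      apply: leq_trans (_ : \sum_(v in A) n ^ 2 <= _); last by rewrite sum_nat_const.
      rewrite big_mkcond [X in _ <= X]big_mkcond; apply: leq_sum => v _.
      by case: (v \in L); case: (v \in A); rewrite //= leq_exp2r // deg_le.
    rewrite big_distrr; apply: leq_sum => v _; rewrite expnS expn1 leq_mul2r.
    by rewrite deg_le orbT.
have [T [TA cT]] : exists T : {set 'I_n}, T \subset A /\ #|T| = minn k.+1 #|A|.
  exists [set v in take k.+1 (enum A)]; split.
    by apply/subsetP => v; rewrite inE => /mem_take; rewrite mem_enum.
  rewrite cardsE; have /card_uniqP -> := take_uniq k.+1 (enum_uniq A).
  by rewrite size_take_min -cardE.
have hA : {in T, forall a, h * (n - deg g a) <= n}.
  by move=> a /(subsetP TA); rewrite inE.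
case: (ltnP k #|A|) => [kA'|Ak]; last first.
  exists A; split; first by apply/eqP; rewrite eqn_leq Ak kA.
  by move=> a; rewrite inE.
case/negP: fr; apply: (@broom_of_bip l s k n g T (cnb g T)) => //.
- by rewrite cT leq_min leqnn kA'.
- have cw := card_cnb g T.
  have : h * \sum_(a in T) (n - deg g a) <= k.+1 * n.
    rewrite big_distrr /=; apply: leq_trans (_ : \sum_(a in T) n <= _).
      exact: leq_sum.
    by rewrite sum_nat_const cT leq_mul2r geq_minl orbT.
  have : k.+1.*2 * \sum_(a in T) (n - deg g a) <= h * \sum_(a in T) (n - deg g a).
    by rewrite leq_mul2r kh orbT.
  set Y := \sum_(a in T) _ in cw *; set C := #|_| in cw *.
  move=> /leq_trans le /le; rewrite -doubleMl doubleMr leq_pmul2l // => Yn.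
  by clearbody Y C; lia.
- by move=> t w tT wc; exact: cnbP tT wc.
Qed.

(** * Rigidity of near-extremal graphs *)

Lemma card_nonnb n (g : graph n) x : simple g ->
  #|~: (x |: nb g x)| = n - 1 - deg g x.
Proof.
move=> sg; rewrite -[X in X - _ - _]card_ord -(cardsC (x |: nb g x)).
by rewrite cardsU1 in_nb adjxx // -addnA addKn addKn.
Qed.

Lemma deg_lt n (g : graph n) x : simple g -> deg g x <= n - 1.
Proof.
move=> sg; rewrite -[X in _ <= X - _]card_ord -(cardsC (x |: nb g x)).
by rewrite cardsU1 in_nb adjxx // -addnA addKn leq_addr.
Qed.

Lemma leq_pow2r a b r : a <= b -> a ^ r <= b ^ r.
Proof. by case: r => // r; rewrite leq_exp2r. Qed.

(** Each unit by which a degree falls short of [m] costs at least [m ^ r.-1], since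
    [d ^ r <= d * m ^ r.-1] for [d <= m]. *)
Lemma sum_pow_deficit n (A : {set 'I_n}) (d : 'I_n -> nat) m r : 0 < r ->
  {in A, forall a, d a <= m} ->
  \sum_(a in A) d a ^ r + (\sum_(a in A) (m - d a)) * m ^ r.-1 <= #|A| * m ^ r.
Proof.
case: r => // r _ dm; rewrite big_distrl -big_split -sum_nat_const.
apply: leq_sum => a /dm da /=; rewrite !expnS -[X in _ <= X * _](subnKC da) mulnDl leq_add2r.
by rewrite leq_mul2l leq_pow2r ?orbT.
Qed.

(* m is the degree deficit of the hubs, u the number of vertices missed by some
   hub, c = (k+1)^r - k^r, and Qn counts the vertices matched outside the hubs. *)
Lemma rigid_arith u k D n r h E Qn q m c :
  0 < k -> 1 < r -> E = 2 * k + 4 * D + c.+1 -> h = 4 * k.+1 * E -> (E * k).*2 + 2 <= n ->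
  h * u <= k * n -> u <= m -> Qn <= q.+1 -> 0 < c ->
  m * (n - 1) ^ r.-1 + q * c <= (k + 2 * u) ^ r.-1 * ((k + D.*2) * (2 * u)) + Qn * c ->
  [/\ u = 0, m = 0 & q <= Qn].
Proof.
move=> k0 r1 Ed hd nE hu um Qq c0 H.
have E0 : 0 < E by lia.
(* If [u = 0], the possible gain is a single [c], as [Qn <= q.+1]. It is below [(n - 1) ^ r.-1], so
   any positive deficit [m] would lose. *)
have [u0|u0] := posnP u.
  have cE : c < E by lia.
  have cn : c < (n - 1) ^ r.-1.
    have : c < n - 1 by nia.
    case: r r1 {H} => [|[|r]] //= _ cn; apply: leq_trans cn _.
    by rewrite -[X in X <= _]expn1 leq_pexp2l //; lia.
  have m0 : m = 0.
    apply/eqP; rewrite -leqn0 leqNgt; apply/negP => m0.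
    have : (n - 1) ^ r.-1 <= m * (n - 1) ^ r.-1 by rewrite leq_pmull.
    have : Qn * c <= q.+1 * c by rewrite leq_mul2r Qq orbT.
    by move: H; rewrite u0 mulSn !muln0; lia.
  split=> //; move: H; rewrite u0 m0 !muln0 mul0n !add0n leq_mul2r.
  by case/orP=> // /eqP c00; rewrite c00 in c0.
exfalso.
(* [h] makes [2 * E * u] at most [n / 2], and the lower bound on [n] takes care of [E * k]. Hence
   [u] vertices cost at least [u * E * (k + 2u) ^ r.-1], and [E] was chosen to exceed what they and
   the extra [c] bring in. *)
have Eu : E * (k + 2 * u) <= n - 1.
  have : 4 * E * u <= n.
    rewrite -(leq_pmul2l k0); apply: leq_trans hu; rewrite hd.
    by rewrite [k * _]mulnC -!mulnA [4 * _]mulnC -!mulnA; nia.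
  by lia.
case: r r1 H => [|[|r]] //= _; set x := k + 2 * u => H.
have x0 : 0 < x by rewrite /x; lia.
have le : x ^ r.+1 * E <= (n - 1) ^ r.+1.
  rewrite [x ^ _]expnS [x * _]mulnC -mulnA [x * E]mulnC [X in _ <= X]expnS mulnC leq_mul //.
  case: r {H} => // r; rewrite leq_exp2r //; apply: leq_trans Eu; rewrite -/x.
  by rewrite leq_pmull.
have : u * (x ^ r.+1 * E) <= m * (n - 1) ^ r.+1 by rewrite leq_mul.
have : Qn * c <= q.+1 * c by rewrite leq_mul2r Qq orbT.
have : c <= u * (x ^ r.+1) * c by rewrite leq_pmull // muln_gt0 u0 expn_gt0 x0.
have : 0 < u * x ^ r.+1 by rewrite muln_gt0 u0 expn_gt0 x0.
move: H; rewrite mulSn Ed; set p := x ^ r.+1; set w := (n - 1) ^ _; set mw := m * w.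
move: p mw => p mw; lia.
Qed.

Lemma card_nb_split n (g : graph n) x (A B : {set 'I_n}) :
  nb g x \subset A :|: B -> deg g x <= #|A| + #|nb g x :&: B|.
Proof.
move=> sub; rewrite degE -{1}(setIidPl sub) setIUr.
apply: leq_trans (leq_card_setU _ _) _; rewrite leq_add2r.
by rewrite subset_leq_card ?subsetIr.
Qed.

(** Split [e_r] over [A], [Y] and [W :\: Z]. Every vertex of [U] costs the hubs a unit of degree,
    and vertices of [Y] have degree at most [k + 2 * #|U|]. A vertex of [W :\: Z] has at most one
    neighbour outside [A], by the path hypothesis, and has one only if it lies in [Q]. [rigid_arith]
    compares the three sums. *)
Lemma rigid l s r k q n (g : graph n) (A : {set 'I_n}) :
  let W := cnb g A in
  let Q := [set w in W | [exists y in W, adj g w y]] in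
  let c := k.+1 ^ r - k ^ r in
  let E := 2 * k + 4 * (l + s) + c.+1 in
  0 < k -> 1 < r -> 1 < l -> simple g -> Ffree (broom l s) g -> #|A| = k ->
  {in A, forall a, 4 * k.+1 * E * (n - deg g a) <= n} -> (E * k).*2 + 2 <= n ->
  (forall w y z, w \in W -> y \notin A -> z \notin A ->
     adj g w y -> adj g y z -> z = w) ->
  k * (n - 1) ^ r + (n - k) * k ^ r + q * c <= e_r r g -> #|Q| <= q.+1 ->
  [/\ ~: A \subset W, {in A, forall a, deg g a = n - 1} & q <= #|Q|].
Proof.
move=> W Q c E k0 r1 l1 sg fr cA hA nE P3 eg cQ.
pose U := ~: (A :|: W).
pose Z := [set w in W | [exists u in U, adj g w u]].
(* [Y] is closed under neighbours outside [A], and [P3] makes [Z] inject into [U]. *)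
pose Y := U :|: Z.
pose m := \sum_(a in A) (n - 1 - deg g a).
have WnA w : w \in W -> w \notin A.
  by move=> wW; apply/negP => wA; have := cnbP wA wW; rewrite adjxx.
have UnA u : u \in U -> u \notin A by rewrite !inE negb_or => /andP[].
have UnW u : u \in U -> u \notin W by rewrite in_setC in_setU negb_or => /andP[].
have inZ w : (w \in Z) = (w \in W) && [exists u in U, adj g w u] by rewrite [LHS]inE.
have inQ w : (w \in Q) = (w \in W) && [exists y in W, adj g w y] by rewrite [LHS]inE.
have um : #|U| <= m.
  apply: leq_trans (card_missed (_ : [disjoint U & W])) _.
    by rewrite disjoints_subset setCS subsetUr.
  apply: leq_sum => a aA; rewrite -card_nonnb //; apply/subset_leq_card/subsetP => u.
  case/setDP=> uU; rewrite in_nb => au; rewrite in_setC in_setU1 in_nb negb_or au andbT.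
  by apply: contraNneq (UnA _ uU) => ->.
have hm : 4 * k.+1 * E * #|U| <= k * n.
  apply: leq_trans (_ : 4 * k.+1 * E * m <= _); first by rewrite leq_mul2l um orbT.
  rewrite -[X in _ <= X * _]cA -sum_nat_const big_distrr; apply: leq_sum => a aA.
  by apply: leq_trans (hA a aA); rewrite /= leq_mul2l leq_sub2r ?orbT ?leq_subr.
have cZ : #|Z| <= #|U|.
  pose f w := odflt w [pick u in U | adj g w u].
  have fP w : w \in Z -> f w \in U /\ adj g w (f w).
    rewrite /f inZ => /andP[wW /exists_inP[u uU wu]].
    by case: pickP => [v /andP[]|/(_ u)] //=; rewrite uU wu.
  rewrite -(@card_in_imset _ _ f); first apply: subset_leq_card.
    by apply/subsetP => _ /imsetP[w /fP[? _] ->].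
  move=> w w' wZ wZ' ff; have [fU wf] := fP w wZ; have [_ wf'] := fP w' wZ'.
  move: wZ wZ'; rewrite !inZ => /andP[wW _] /andP[wW' _].
  symmetry; apply: (P3 w (f w)) => //; [exact: UnA | exact: WnA | by rewrite ff adjC].
have cY : #|Y| <= 2 * #|U|.
  by rewrite mul2n -addnn; apply: leq_trans (leq_card_setU _ _) _; rewrite leq_add2l.
have nbY y : y \in Y -> nb g y \subset A :|: Y.
  move=> yY; apply/subsetP => z; rewrite in_nb => yz.
  rewrite in_setU orbC; case: (boolP (z \in A)) => zA; rewrite ?orbT ?orbF //.
  have [zU|] := boolP (z \in U); first by rewrite in_setU zU.
  rewrite in_setC in_setU (negbTE zA) negbK /= => zW.
  case/setUP: yY => [yU|].
    rewrite in_setU inZ zW /=; apply/orP; right.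
    by apply/exists_inP; exists y; rewrite // adjC.
  rewrite inZ => /andP[yW /exists_inP[u uU yu]].
  (* A neighbour [z] of [y] in [W] would start a path [z], [y], [u] outside [A], forcing [u = z],
     although [u] is not in [W]. *)
  have uz := P3 z y u zW (WnA _ yW) (UnA _ uU); move: uz; rewrite adjC // => /(_ yz yu) uz.
  by move: (UnW _ uU); rewrite uz zW.
(* One factor of each power is kept as a degree and summed with [sum_deg_in], so the last factor
   averages to a constant instead of growing with [#|U|]. *)
have sY : \sum_(y in Y) deg g y ^ r <=
    (k + 2 * #|U|) ^ r.-1 * ((k + (l + s).*2) * (2 * #|U|)).
  apply: leq_trans (_ : \sum_(y in Y) (k + 2 * #|U|) ^ r.-1 * deg g y <= _).
    apply: leq_sum => y yY; rewrite -{1}(prednK (ltnW r1)) expnSr leq_mul2r leq_pow2r ?orbT //.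
    apply: leq_trans (card_nb_split (nbY y yY)) _; rewrite cA leq_add2l.
    by apply: leq_trans cY; rewrite subset_leq_card ?subsetIr.
  rewrite -big_distrr leq_mul2l; apply/orP; right => /=.
  apply: leq_trans (_ : (k + (l + s).*2) * #|Y| <= _); last by rewrite leq_mul2l cY orbT.
  rewrite mulnDl; apply: leq_trans (leq_add (leqnn _) (sum_deg_in Y l1 sg fr)).
  rewrite [k * _]mulnC -sum_nat_const -big_split; apply: leq_sum => y yY.
  by rewrite -[X in _ <= X + _]cA; exact: card_nb_split (nbY y yY).
have sW : \sum_(w in W :\: Z) deg g w ^ r <= (n - k) * k ^ r + #|Q| * c.
  apply: leq_trans (_ : \sum_(w in W :\: Z) (k ^ r + (w \in Q) * c) <= _).
    apply: leq_sum => w /setDP[wW wZ].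
    have nbw : nb g w \subset A :|: W.
      apply/subsetP => z; rewrite in_nb => wz; apply: contraR wZ => zU.
      by rewrite inZ wW; apply/exists_inP; exists z; rewrite // in_setC.
    have dw := card_nb_split nbw; rewrite cA in dw.
    have [wQ|wQ] := boolP (w \in Q).
      rewrite mul1n subnKC; last by rewrite leq_pow2r.
      apply: leq_pow2r; apply: leq_trans dw _; rewrite -addn1 leq_add2l.
      apply/card_le1P => y /setIP[]; rewrite in_nb => wy yW y'.
      rewrite in_setI in_nb [RHS]inE; apply/idP/eqP => [/andP[wy' y'W]|-> ].
        by apply: (P3 y w y') => //; [exact: WnA|exact: WnA|rewrite adjC].
      by rewrite wy yW.
    rewrite mul0n addn0; apply: leq_pow2r; apply: leq_trans dw _.
    rewrite (_ : nb g w :&: W = set0) ?cards0 ?addn0 //.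
    apply/setP => y; rewrite in_setI in_nb in_set0; apply/negP => /andP[wy yW].
    by case/negP: wQ; rewrite inQ wW; apply/exists_inP; exists y.
  rewrite big_split /= sum_nat_const leq_add //.
    rewrite leq_mul2r; apply/orP; right.
    rewrite -cA -[X in X - _]card_ord -cardsT -cardsDS ?subsetT //.
    apply/subset_leq_card/subsetP => w /setDP[wW _].
    by rewrite in_setD in_setT WnA.
  rewrite -big_distrl leq_mul2r; apply/orP; right => /=.
  rewrite -sum1_card big_mkcond [X in _ <= X]big_mkcond; apply: leq_sum => w _.
  by case: (w \in Q); case: ifP.
have sA : \sum_(a in A) deg g a ^ r + m * (n - 1) ^ r.-1 <= k * (n - 1) ^ r.
  by rewrite -cA; apply: sum_pow_deficit => [|a _]; [exact: ltnW | exact: deg_lt].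
have eE : e_r r g = \sum_(a in A) deg g a ^ r + \sum_(y in Y) deg g y ^ r
                    + \sum_(w in W :\: Z) deg g w ^ r.
  rewrite /e_r (bigID [in A]) -addnA; congr (_ + _).
  rewrite (bigID [in Y]) /=; congr (_ + _); apply: eq_bigl => y.
    rewrite andbC; case: (boolP (y \in Y)) => //= /setUP[/UnA //|].
    by rewrite inZ => /andP[/WnA].
  rewrite !in_setU in_setD !negb_or in_setC in_setU negbK.
  case: (boolP (y \in W)) => [/WnA/negbTE->|_]; first by rewrite andbT.
  by rewrite orbF andbF; case: (y \in A).
have c0 : 0 < c by rewrite subn_gt0 ltn_exp2r // ltnW.
have [|U0 m0 qQ] := @rigid_arith #|U| k (l + s) n r _ E #|Q| q m c k0 r1 erefl
  erefl nE hm um cQ c0.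
  move: eg sA sY sW; rewrite eE; move: #|Q| => Qn.
  set a1 := \sum_(a in A) _; set a2 := \sum_(a in Y) _; set a3 := \sum_(w in _) _.
  set b1 := m * _; set b2 := _ * (_ * _); set b3 := (n - k) * _; set b4 := k * _.
  move: a1 a2 a3 b1 b2 b3 b4; clear; lia.
split=> //.
  apply/subsetP => x; rewrite in_setC => xA; apply: contraT => xW.
  have : x \in U by rewrite in_setC in_setU negb_or xA xW.
  by rewrite (cards0_eq U0) in_set0.
move=> a aA; apply/eqP; rewrite eqn_leq deg_lt //= -subn_eq0.
by move/eqP: m0; rewrite /m sum_nat_eq0 => /forall_inP/(_ a aA).
Qed.

(** * The extremal graphs as members of one family *)

(* Common generalisation of the three extremal graphs: the vertices below k
   dominate, and k, ..., k+q-1 (q even) are matched as {k,k+1}, {k+2,k+3}, ... *)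
Definition pairb k q i j := [&& k <= i, ~~ odd (i - k), j == i.+1 & j < k + q].

Definition Hmatch k q n : graph n :=
  [ffun p : 'I_n * 'I_n => (val p.1 != val p.2) &&
     [|| val p.1 < k, val p.2 < k, pairb k q (val p.1) (val p.2)
       | pairb k q (val p.2) (val p.1)]].

Lemma HknE k n : Hkn k n = Hmatch k 0 n.
Proof.
apply/ffunP => -[x y]; rewrite !ffunE /= /pairb; congr (_ && _).
by lia.
Qed.

Lemma HstarE k n : Hstar k n = Hmatch k 2 n.
Proof. apply/ffunP => -[x y]; rewrite !ffunE /= /pairb; lia. Qed.

Lemma FnE n : Fn n = Hmatch 1 (n - 1)./2.*2 n.
Proof.
apply/ffunP => -[x y]; rewrite !ffunE /= /pairb.
have := ltn_ord x; have := ltn_ord y; move: (val x) (val y) => i j; lia.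
Qed.

Lemma simple_Hmatch k q n : simple (Hmatch k q n).
Proof.
apply/andP; split; apply/forallP => x; first by rewrite /adj ffunE eqxx.
apply/forallP => y; apply/eqP; rewrite /adj !ffunE /= eq_sym; congr (_ && _).
by rewrite orbCA [pairb _ _ x y || _]orbC.
Qed.

Lemma card_ord_lt n k : k <= n -> #|[set i : 'I_n | i < k]| = k.
Proof.
move=> kn; rewrite -sum1dep_card -(big_ord_widen n (fun=> 1)) //.
by rewrite sum1_card card_ord.
Qed.

Lemma deg_ge n (g : graph n) x (S : {set 'I_n}) :
  {in S, forall y, adj g x y} -> #|S| <= deg g x.
Proof.
by move=> H; apply/subset_leq_card/subsetP => y /H; rewrite inE.
Qed.

(** Degrees are bounded below by exhibiting neighbours; this direction supplies the lower bound on
    [e_r] that [rigid] requires of a competitor. *)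
Lemma e_r_Hmatch r k q n : 0 < r -> k + q <= n -> ~~ odd q ->
  k * (n - 1) ^ r + (n - k) * k ^ r + q * (k.+1 ^ r - k ^ r) <= e_r r (Hmatch k q n).
Proof.
move=> r0 kqn q2; set c := k.+1 ^ r - _.
have kn : k <= n by lia.
pose A := [set i : 'I_n | i < k]; pose Q := [set i : 'I_n | k <= i < k + q].
have cA : #|A| = k := card_ord_lt kn.
have cQ : #|Q| = q.
  have -> : Q = [set i : 'I_n | i < k + q] :\: A.
    by apply/setP => i; rewrite !inE -leqNgt.
  rewrite cardsDS ?card_ord_lt ?cA ?addKn //.
  by apply/subsetP => i; rewrite !inE => /leq_trans-> //; rewrite leq_addr.
rewrite /e_r (bigID [in A]) /= -addnA leq_add //.
  rewrite -[X in X * _]cA -sum_nat_const; apply: leq_sum => i; rewrite inE => ik.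
  have /deg_ge : {in [set~ i], forall j, adj (Hmatch k q n) i j}.
    by move=> j; rewrite !inE /adj ffunE /= ik andbT eq_sym.
  by rewrite cardsC1 card_ord -subn1 => /leq_pow2r ->.
apply: leq_trans (_ : \sum_(i in ~: A) (k ^ r + (i \in Q) * c) <= _).
  rewrite big_split /= sum_nat_const leq_add //.
    by rewrite cardsCs setCK card_ord cA.
  rewrite -big_distrl; apply: leq_mul; last exact: leqnn.
  rewrite -cQ -sum1_card big_mkcond [X in _ <= X]big_mkcond; apply: leq_sum => i _.
  by rewrite !inE; case: (leqP k i).
rewrite [X in _ <= X](eq_bigl [in ~: A]) => [|i]; last by rewrite /= in_setC.
apply: leq_sum => i; rewrite in_setC => /negbTE iA.
have AS : {in A, forall j, adj (Hmatch k q n) i j}.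
  move=> j jA; rewrite /adj ffunE /=; move: jA iA; rewrite !inE => jk ik.
  by rewrite jk orbT andbT; lia.
have [iQ|iQ] := boolP (i \in Q); last first.
  by rewrite addn0 leq_pow2r // -[X in X <= _]cA; apply: deg_ge.
rewrite mul1n subnKC ?leq_pow2r //.
(* The index of the partner of [i] in the matching. *)
have jn : (if odd (i - k) then i.-1 else i.+1) < n.
  by move: iQ; rewrite inE; have := ltn_ord i; case: ifP; lia.
have jnA : Ordinal jn \notin A.
  by move: iA iQ; rewrite !inE /=; case: ifP; lia.
suff /deg_ge : {in Ordinal jn |: A, forall j, adj (Hmatch k q n) i j}.
  by rewrite cardsU1 jnA cA => H.
move=> j /setU1P[->|]; last exact: AS.
rewrite /adj ffunE /= /pairb; move: iQ; rewrite inE; clear -q2; case: ifP; lia.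
Qed.

(** Remove one matched pair at a time. The list puts partners at positions [2i] and [2i + 1], the
    layout of [Hmatch]. *)
Lemma pair_list n (g : graph n) (M : {set 'I_n}) : simple g ->
  {in M, forall x, exists2 y, y \in M & adj g x y} ->
  {in M & &, forall x y z, adj g x y -> adj g y z -> z = x} ->
  exists e : seq 'I_n, [/\ uniq e, e =i M, ~~ odd (size e) &
    forall x0 i, ~~ odd i -> i < size e -> adj g (nth x0 e i) (nth x0 e i.+1)].
Proof.
move=> sg; move: {2}#|M|.+1 (ltnSn #|M|) => c; elim: c M => // c IH M cM ex un.
have [->|[x xM]] := set_0Vmem M.
  by exists [::]; split=> // x; rewrite inE.
have [y yM xy] := ex x xM.
pose M' := M :\: [set x; y].
have subM z : z \in M' -> z \in M by case/setDP.
have [|z /setDP[zM zxy]|a b d /subM aM /subM bM /subM dM|e [ue eM oe pe]] := IH M'.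
- apply: leq_trans (_ : #|M| <= _); last by rewrite -ltnS.
  by apply/proper_card/properP; split; [exact: subsetDl | exists x; rewrite // !inE eqxx].
- have [w wM zw] := ex z zM; exists w => //; apply/setDP; split=> //.
  apply: contra zxy; rewrite !inE => /orP[]/eqP wE; rewrite wE in zw.
    by rewrite (un y x z) ?eqxx ?orbT // adjC.
  by rewrite (un x y z) ?eqxx // adjC.
- exact: un.
exists [:: x, y & e]; split=> /=.
- rewrite ue inE negb_or !eM !inE !eqxx ?orbT !andbT /=.
  by apply: contraTneq xy => ->; rewrite adjxx.
- move=> z; rewrite !inE eM !inE; case: (eqVneq z x) => [->|_] //=.
  by case: (eqVneq z y) => [->|_].
- by rewrite negbK.
move=> x0 [|[|i]] //=; rewrite negbK !ltnS; exact: pe.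
Qed.

(** List the vertices as [A], then the matched pairs from [pair_list], then the rest. Sending [i] to
    the [i]-th entry of this list is the isomorphism. *)
Lemma iso_Hmatch n k (g : graph n) (A : {set 'I_n}) :
  let Q := [set x in ~: A | [exists y in ~: A, adj g x y]] in
  simple g -> #|A| = k -> (forall a x, a \in A -> x != a -> adj g a x) ->
  {in ~: A & &, forall x y z, adj g x y -> adj g y z -> z = x} ->
  ~~ odd #|Q| /\ isomorphic g (Hmatch k #|Q| n).
Proof.
move=> Q sg cA dom un.
have QA x : x \in Q -> x \in ~: A by rewrite inE => /andP[].
have [||e [ue eQ oe pe]] := @pair_list n g Q sg.
- move=> x; rewrite inE => /andP[xA /exists_inP[y yA xy]]; exists y => //.
  by rewrite inE yA; apply/exists_inP; exists x; rewrite // adjC.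
- by move=> x y z /QA xA /QA yA /QA zA; apply: un.
have sQ : size e = #|Q| by rewrite -(eq_card eQ); apply/esym/card_uniqP.
rewrite -sQ; split=> //; set q := size e in sQ *.
pose R := ~: (A :|: Q); pose E := enum A ++ e ++ enum R.
have sA : size (enum A) = k by rewrite -cardE.
have uE : uniq E.
  rewrite !cat_uniq !enum_uniq ue has_cat !negb_or /= andbT; rewrite -andbA; apply/and3P; split.
  - by apply/hasPn => x; rewrite eQ mem_enum => /QA; rewrite in_setC.
  - apply/hasPn => x; rewrite !mem_enum in_setC in_setU negb_or => /andP[] //.
  - by apply/hasPn => x; rewrite mem_enum in_setC in_setU negb_or -eQ => /andP[].
have sE : size E = n.
  rewrite -[RHS]card_ord -(card_uniqP uE); apply: eq_card => x.
  rewrite !mem_cat !mem_enum eQ in_setC in_setU.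
  by case: (x \in A); case: (x \in Q).
have inR (i : 'I_n) : k + q <= i -> nth i (enum R) (i - k - size e) \in enum R.
  move=> qi; rewrite mem_nth // -subnDA ltn_subLR // -addnA.
  by rewrite -[X in X + _]sA -!size_cat -/E sE ltn_ord.
pose f (i : 'I_n) := nth i E i.
have fE (i j : 'I_n) : f i = nth j E i by apply: set_nth_default; rewrite sE.
have fI : injective f.
  move=> i j; rewrite (fE i j) => /eqP.
  by rewrite nth_uniq ?sE // => /eqP/val_inj.
have fA (i : 'I_n) : (f i \in A) = (i < k).
  rewrite /f /E nth_cat sA; case: ltnP => ik.
    by rewrite -mem_enum mem_nth ?sA.
  apply/negbTE; rewrite -in_setC nth_cat; case: ltnP => ie.
    by apply: QA; rewrite -eQ mem_nth.
  have: nth i (enum R) (i - k - size e) \in enum R by apply: inR; lia.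
  by rewrite mem_enum /R !in_setC in_setU negb_or => /andP[].
have fQ (i : 'I_n) : k <= i < k + q -> f i = nth i e (i - k).
  by move=> /andP[ki iq]; rewrite /f /E nth_cat sA ltnNge ki /= nth_cat ltn_subLR // iq.
have fQ' (i : 'I_n) : f i \in Q -> k <= i < k + q.
  move=> fi; have ki : k <= i by rewrite leqNgt -fA -in_setC QA.
  rewrite ki /= ltnNge; apply/negP => qi; move: fi.
  rewrite /f /E nth_cat sA ltnNge ki /= nth_cat ltn_subLR // ltnNge qi /=.
  have := inR i qi.
  by rewrite mem_enum in_setC in_setU negb_or => /andP[_ /negbTE->].
have pairP (i j : 'I_n) : pairb k q i j -> adj g (f i) (f j).
  case/and4P => ki oi /eqP ji jq; rewrite !fQ; try lia.
  rewrite ji subSn // (set_nth_default i) ?pe //; rewrite -/q; lia.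
exists (perm fI) => i j; rewrite !permE {2}/adj ffunE /= -/(f i) -/(f j).
have [ij|ij] := eqVneq (i : nat) j; first by rewrite (val_inj ij) adjxx.
have fij : f i != f j by apply: contra ij => /eqP/fI ->.
have [ik|ki] := ltnP i k; first by rewrite dom ?fA // eq_sym.
have [jk|kj] := ltnP j k; first by rewrite adjC // dom ?fA.
apply/idP/idP => /= [aij|/orP[/pairP //|/pairP]]; last by rewrite adjC.
have iA : f i \in ~: A by rewrite in_setC fA -leqNgt.
have jA : f j \in ~: A by rewrite in_setC fA -leqNgt.
have iQ : k <= i < k + q by apply: fQ'; rewrite inE iA; apply/exists_inP; exists (f j).
(* [i'] is the position paired with [i]. As [f i] has only one neighbour outside [A], the index [j]
   must equal [i']. *)
have i'n : (if odd (i - k) then i.-1 else i.+1) < n.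
  have : k + q <= n by rewrite -sE !size_cat sA addnA leq_addr.
  by rewrite -/q in oe; move: iQ oe (ltn_ord i); clear; case: ifP; lia.
pose i' := Ordinal i'n.
have i'A : f i' \in ~: A by rewrite in_setC fA /=; move: iQ; clear; case: ifP; lia.
have pr : pairb k q i i' || pairb k q i' i.
  by rewrite /pairb /=; clear -oe iQ; case: ifP; rewrite -/q in oe; lia.
have ai : adj g (f i') (f i).
  by case/orP: pr => /pairP //; rewrite adjC.
have /fI -> // : f j = f i' by apply: (un (f i') (f i)).
Qed.

(** * Broom-freeness of the extremal graphs *)

(** Keeps only the spine: for [Hmatch k 0] and [Hmatch k 2] the path alone is already excluded. *)
Lemma broom_path l s n (G : graph n) : 1 < l -> contains (broom l s) G ->
  exists F : nat -> 'I_n, (forall i j, i < l -> j < l -> F i = F j -> i = j) /\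
    (forall i, i.+1 < l -> adj G (F i) (F i.+1)).
Proof.
move=> l1 /existsP[f /andP[/injectiveP fI /forallP fadj]].
have p0 : 0 < l + s by lia.
pose o i : 'I_(l + s) := insubd (Ordinal p0) i.
have oE i : i < l -> val (o i) = i by move=> il; rewrite val_insubd; case: ifP; lia.
exists (f \o o); split=> [i j il jl /fI/(congr1 val)|i il] /=; first by rewrite !oE.
have /forallP/(_ (o i.+1))/implyP := fadj (o i); apply.
by rewrite /adj ffunE /= !oE; lia.
Qed.

(* Each vertex of A lies on at most two edges of the path F. *)
Lemma card_uncovered n l k (A : {set 'I_n}) (F : nat -> 'I_n) : #|A| <= k ->
  (forall i j, i < l -> j < l -> F i = F j -> i = j) ->
  l.-1 - k.*2 <= #|[set i : 'I_l.-1 | (F i \notin A) && (F i.+1 \notin A)]|.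
Proof.
move=> cA FI; set B := [set i | _].
(* [h] will be the identity and the successor, for the left and right ends of the path edges. *)
have le (h : 'I_l.-1 -> nat) : injective h -> (forall i, h i < l) ->
    #|[set i : 'I_l.-1 | F (h i) \in A]| <= k.
  move=> hI hl; apply: leq_trans cA; rewrite -(@card_in_imset _ _ (F \o h)).
    by apply/subset_leq_card/subsetP => _ /imsetP[i + ->]; rewrite inE.
  by move=> i j _ _ /= /FI e; apply/hI/e.
have le1 := le val val_inj; have le2 := le (fun i => (val i).+1).
have {le1} := le1 (fun i => leq_trans (ltn_ord i) (leq_pred l)).
have {le2} : #|[set i : 'I_l.-1 | F i.+1 \in A]| <= k.
  by apply: le2 => [i j [/val_inj]|i] //; case: i => i /= il; lia.
set B2 := [set i | _] => le2; set B1 := [set i | _] => le1.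
rewrite leq_subLR -[X in X <= _]card_ord -(cardsC B) addnC leq_add2r.
rewrite -addnn; apply: leq_trans (leq_add le1 le2).
apply: leq_trans (leq_card_setU B1 B2); apply/subset_leq_card/subsetP => i.
by rewrite !inE negb_and !negbK.
Qed.

Lemma card_ord_lt_le n k : #|[set i : 'I_n | i < k]| <= k.
Proof.
have [/card_ord_lt-> //|/ltnW nk] := leqP k n.
by apply: leq_trans nk; rewrite -[X in _ <= X]card_ord max_card.
Qed.

(** The [k] dominating vertices cover at most [2k] of the [2k + 1] path edges, and no edge avoids
    them. *)
Lemma Hmatch0_free k s n : Ffree (broom k.*2.+2 s) (Hmatch k 0 n).
Proof.
apply/negP => /broom_path[] // F [FI Fadj].
have := card_uncovered (card_ord_lt_le n k) FI.
rewrite subSn // subnn => /card_gt0P[i]; rewrite !inE.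
have := Fadj i; rewrite ltnS ltn_ord => /(_ isT); rewrite /adj ffunE /= /pairb; lia.
Qed.

(** Now the path has [2k + 2] edges, so two of them avoid the dominating vertices, where the graph
    has a single edge. *)
Lemma Hmatch2_free k s n : Ffree (broom k.*2.+3 s) (Hmatch k 2 n).
Proof.
apply/negP => /broom_path[] // F [FI Fadj].
have := card_uncovered (card_ord_lt_le n k) FI.
rewrite !subSn // subnn => /card_gt1P[i [j []]]; rewrite !inE => iB jB /eqP ij.
case: ij; apply/val_inj.
have key (t : 'I_k.*2.+2) :
   (F t \notin [set i : 'I_n | i < k]) && (F t.+1 \notin [set i : 'I_n | i < k]) ->
   (val (F t) = k /\ val (F t.+1) = k.+1) \/ (val (F t) = k.+1 /\ val (F t.+1) = k).
  have := Fadj t; rewrite ltnS ltn_ord => /(_ isT); rewrite /adj ffunE /pairb !inE /=.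
  by case: (F t) (F t.+1) => [a ?] [b ?] /=; lia.
have FI' a b : a < k.*2.+3 -> b < k.*2.+3 -> val (F a) = val (F b) -> a = b.
  by move=> al bl /val_inj; apply: FI.
have := key i; rewrite !inE iB => /(_ isT).
have := key j; rewrite !inE jB => /(_ isT).
move=> /=; move: (nat_of_ord i) (nat_of_ord j) (ltn_ord i) (ltn_ord j) => a b il jl.
have E c d v : c < k.*2.+3 -> d < k.*2.+3 -> val (F c) = v -> val (F d) = v -> c = d.
  by move=> cl dl cv dv; apply: FI'; rewrite ?cv ?dv.
have jl' : b < k.*2.+3 := ltnW jl; have il' : a < k.*2.+3 := ltnW il.
have {}jl : b.+1 < k.*2.+3 := jl; have {}il : a.+1 < k.*2.+3 := il.
(* Traversed in the same direction, the two path edges coincide; in opposite directions, [a.+1 = b]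
   and [b.+1 = a]. *)
case=> -[j0 j1] [] [i0 i1].
- exact: E il' jl' i0 j0.
- have e1 := E _ _ _ il jl' i1 j0; have e2 := E _ _ _ il' jl i0 j1; lia.
- have e1 := E _ _ _ il jl' i1 j0; have e2 := E _ _ _ il' jl i0 j1; lia.
- exact: E il' jl' i0 j0.
Qed.

Lemma adj_Fn n (x y : 'I_n) : adj (Fn n) x y ->
  [\/ x = 0 :> nat, y = 0 :> nat | y = (if odd x then x.+1 else x.-1) :> nat].
Proof.
rewrite /adj ffunE /=; move: (nat_of_ord x) (nat_of_ord y) => a b.
case/andP=> _ /or4P[/eqP->|/eqP->|/andP[-> /eqP->]|/andP[ob /eqP->]].
- by apply: Or31.
- by apply: Or32.
- by apply: Or33.
- by apply: Or33 => /=; rewrite ob.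
Qed.

(** Away from the centre of [Fn n], a vertex has at most one neighbour other than the centre. Broom
    vertex 1 has the three neighbours 0, 2 and 5, so it is the centre; then 2 and 4 are two further
    neighbours of vertex 3. *)
Lemma Fn_free s n : 0 < s -> Ffree (broom 5 s) (Fn n).
Proof.
move=> s0; apply/negP => /existsP[f /andP[/injectiveP fI /forallP fadj]].
have p0 : 0 < 5 + s by lia.
pose o i : 'I_(5 + s) := insubd (Ordinal p0) i.
have oE i : i < 6 -> val (o i) = i by move=> il; rewrite val_insubd; case: ifP; lia.
pose a i := nat_of_ord (f (o i)).
pose p x := if odd x then x.+1 else x.-1.
have st i j : adj (broom 5 s) (o i) (o j) -> [\/ a i = 0, a j = 0 | a j = p (a i)].
  by move=> h; apply: adj_Fn; have /forallP/(_ (o j))/implyP := fadj (o i); apply.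
have ne i j : i < 6 -> j < 6 -> i != j -> a i <> a j.
  move=> i6 j6 /eqP ij e; apply: ij.
  by rewrite -(oE i) // -(oE j) //; congr val; apply/fI/val_inj.
have nb1 j : j \in [:: 0; 2; 5] -> [\/ a 1 = 0, a j = 0 | a j = p (a 1)].
  by rewrite !inE => /or3P[]/eqP->; apply: st; rewrite /adj ffunE /= !oE.
have nb3 j : j \in [:: 2; 4] -> [\/ a 3 = 0, a j = 0 | a j = p (a 3)].
  by rewrite !inE => /orP[]/eqP->; apply: st; rewrite /adj ffunE /= !oE.
clearbody a p.
have f1 : a 1 = 0.
  have [n02 n05 n25] := And3 (ne 0 2 isT isT isT) (ne 0 5 isT isT isT) (ne 2 5 isT isT isT).
  by case: (nb1 0 isT) (nb1 2 isT) (nb1 5 isT) => // e0 [] // e2 [] // e5; congruence.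
have [n12 n13] := conj (ne 1 2 isT isT isT) (ne 1 3 isT isT isT).
have [n14 n24] := conj (ne 1 4 isT isT isT) (ne 2 4 isT isT isT).
by case: (nb3 2 isT) (nb3 4 isT) => e2 [] e4; congruence.
Qed.

(** * Uniqueness criterion and paths at the common neighbours of the hubs *)

Lemma iso_e_r r n (G H : graph n) : isomorphic G H -> e_r r G = e_r r H.
Proof.
case=> p pH; rewrite /e_r (reindex_inj (@perm_inj _ p)); apply: eq_bigr => x _.
congr (_ ^ _); rewrite /deg -[RHS](card_imset _ (@perm_inj _ p)); apply: eq_card => y.
by rewrite -[y](permKV p) mem_imset ?inE ?pH //; exact: perm_inj.
Qed.

(** A maximiser is itself a competitor at least as good as [H], hence isomorphic to [H], which
    yields the value of the maximum. *)
Lemma unique_extremalI n r m (F : graph m) (H : graph n) :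
  simple H -> Ffree F H ->
  (forall G, simple G -> Ffree F G -> e_r r H <= e_r r G -> isomorphic G H) ->
  unique_extremal n r F H.
Proof.
move=> sH fH HG.
have eH : ex_r n r F = e_r r H.
  rewrite /ex_r (bigmax_eq_arg H) ?sH //; case: arg_maxnP => [|G /andP[sG fG] max].
    by rewrite sH.
  by apply: iso_e_r; apply: HG => //; apply: max; rewrite sH.
by split=> // G [sG fG eG]; apply: HG; rewrite // eG eH.
Qed.

Lemma cnb_notin n (g : graph n) (A : {set 'I_n}) w :
  simple g -> w \in cnb g A -> w \notin A.
Proof.
by move=> sg wW; apply/negP => wA; have := cnbP wA wW; rewrite adjxx.
Qed.

Lemma broom_hubs l s n (g : graph n) (A : {set 'I_n}) x q :
  simple g -> 0 < #|A| -> x \in cnb g A -> all [predC A] q ->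
  path (adj g) x q -> uniq (x :: q) ->
  1 < l <= (size q).+1 + #|A|.*2 -> (size q).+1 + #|A|.*2 + s <= #|cnb g A| ->
  contains (broom l s) g.
Proof.
move=> sg A0 xW /allP qA pq uq ll lW.
apply: (@broom_zigzag l s n g (cnb g A) (enum A) x q) => //.
- by move=> t w; rewrite mem_enum => tA wW; exact: cnbP tA wW.
- exact: enum_uniq.
- by rewrite -cardE.
- move=> t; rewrite mem_enum => tA; rewrite inE negb_or; apply/andP; split.
    by apply: contraTneq tA => ->; exact: cnb_notin xW.
  by apply/negP => /qA /=; rewrite tA.
- by rewrite -cardE.
- by rewrite -cardE.
Qed.

(** The two ends of the edge and a zigzag through the [k] hubs make [2k + 2] vertices. *)
Lemma no_edge_at_cnb k s n (g : graph n) (A : {set 'I_n}) w y :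
  simple g -> Ffree (broom k.*2.+2 s) g -> 0 < k -> #|A| = k ->
  k.*2.+2 + s <= #|cnb g A| -> w \in cnb g A -> y \notin A -> ~~ adj g w y.
Proof.
move=> sg fr k0 cA cW wW yA; apply: contra fr => wy.
apply: (@broom_hubs _ s n g A w [:: y]); rewrite ?cA //= ?yA ?wy //.
by rewrite inE andbT; apply: contraTneq wy => ->; rewrite adjxx.
Qed.

(** As for an edge, with one more vertex: [3 + 2k] in all. *)
Lemma no_path3_at_cnb k s n (g : graph n) (A : {set 'I_n}) w y z :
  simple g -> Ffree (broom k.*2.+3 s) g -> 0 < k -> #|A| = k ->
  k.*2.+3 + s <= #|cnb g A| -> w \in cnb g A -> y \notin A -> z \notin A ->
  adj g w y -> adj g y z -> z = w.
Proof.
move=> sg fr k0 cA cW wW yA zA wy yz; apply/eqP; apply: contraNT fr => zw.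
apply: (@broom_hubs _ s n g A w [:: y; z]); rewrite ?cA //= ?yA ?zA ?wy ?yz //.
rewrite !inE negb_or eq_sym [w == z]eq_sym zw !andbT; apply/andP; split.
  by apply: contraTneq wy => ->; rewrite adjxx.
by apply: contraTneq yz => ->; rewrite adjxx.
Qed.

(** Two disjoint edges in [W] joined through a hub [a] form a path on 5 vertices, and the other
    [k.-1] hubs lengthen it to [2k + 3]. For [k = 1] no hub is left to carry leaves, so this case
    needs [s = 0]. *)
Lemma matched_le2 k s n (g : graph n) (A : {set 'I_n}) :
  let W := cnb g A in
  simple g -> Ffree (broom k.*2.+3 s) g -> 0 < k -> 1 < k \/ s = 0 -> #|A| = k ->
  k.*2.+3 + s <= #|W| ->
  #|[set w in W | [exists y in W, adj g w y]]| <= 2.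
Proof.
move=> W sg fr k0 ks cA cW; set Q := [set w in W | _].
have QP w : w \in Q -> w \in W /\ exists2 y, y \in W & adj g w y.
  by rewrite inE => /andP[wW /exists_inP[y yW wy]]; split=> //; exists y.
have WA w : w \in W -> w \notin A by exact: cnb_notin.
have P3 w y z : w \in W -> y \in W -> z \in W -> adj g w y -> adj g y z -> z = w.
  by move=> wW /WA yA /WA zA; exact: no_path3_at_cnb fr k0 cA cW wW yA zA.
have ne a b : adj g a b -> a != b by apply: contraTneq => ->; rewrite adjxx.
rewrite leqNgt; apply: contra fr => Q2.
have [x] : exists x, x \in Q by apply/card_gt0P; lia.
move/QP=> [xW [y yW xy]].
have [x'] : exists x', x' \in Q :\: [set z in [:: x; y]].
  by apply/card_gt0P/(leq_trans _ (card_setD_seq _ _)); rewrite subn_gt0.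
case/setDP=> /QP[x'W [y' y'W xy']]; rewrite !inE negb_or => /andP[x'x x'y].
have y'x : y' != x.
  apply: contra x'y => /eqP E; rewrite E in xy'.
  by rewrite (P3 x' x y) // eqxx.
have y'y : y' != y.
  apply: contra x'x => /eqP E; rewrite E in xy'.
  by rewrite (P3 x' y x) ?eqxx // adjC.
have [a aA] : exists a, a \in A by apply/card_gt0P; rewrite cA.
have aW w : w \in W -> adj g a w by move=> wW; exact: cnbP aA wW.
have uq : uniq [:: x; y; a; x'; y'].
  have xa : x != a by rewrite eq_sym ne ?aW.
  have ya : y != a by rewrite eq_sym ne ?aW.
  rewrite /= !inE !negb_or (ne _ _ xy) xa ya (eq_sym x) x'x (eq_sym x) y'x.
  by rewrite (eq_sym y) x'y (eq_sym y) y'y !ne ?aW.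
have pq : path (adj g) x [:: y; a; x'; y'].
  by rewrite /= xy (adjC _ _ sg) !aW // xy'.
have [k1|k1] := ltnP 1 k; last first.
  have kE : k = 1 by apply/eqP; rewrite eqn_leq k1.
  case: ks => [|s0]; first by rewrite kE.
  by apply: broom_of_path pq uq _; rewrite // ?kE // s0.
have [kp ll lW] : [/\ 0 < k.-1, 1 < k.*2.+3 <= 5 + k.-1.*2
    & 5 + k.-1.*2 + s <= k.*2.+3 + s] by move: k1; clear; split; lia.
have cB : #|A :\ a| = k.-1 by move: cA; rewrite (cardsD1 a) aA => <-.
have WB w : w \in W -> w \in cnb g (A :\ a).
  move=> wW; rewrite inE; apply/forall_inP => b /setD1P[_ bA]; exact: cnbP bA wW.
apply: (@broom_hubs _ s n g (A :\ a) x [:: y; a; x'; y']) => //.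
- by rewrite cB.
- exact: WB.
- rewrite /= !inE eqxx !negb_and (negbTE (WA _ yW)) (negbTE (WA _ x'W)).
  by rewrite (negbTE (WA _ y'W)) !orbT.
- by rewrite cB.
rewrite cB; apply: leq_trans lW _; apply: leq_trans cW _.
by apply/subset_leq_card/subsetP.
Qed.

(** * Stability and the three cases *)

(** Reduces every exponent to 2, the one used by [hubs]: each [d ^ r] is at most
    [(n - 1) ^ (r - 2) * d ^ 2]. *)
Lemma sum_sqr_deg k r n (g : graph n) : 1 < r -> 1 < n -> simple g ->
  k * (n - 1) ^ r <= e_r r g -> k * (n - 1) ^ 2 <= \sum_x deg g x ^ 2.
Proof.
move=> r1 n1 sg le.
have n0 : 0 < (n - 1) ^ (r - 2) by rewrite expn_gt0 subn_gt0 n1.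
rewrite -(leq_pmul2l n0) mulnCA -expnD subnK //; apply: leq_trans le _.
rewrite big_distrr; apply: leq_sum => x _ /=.
by rewrite -{1}(subnK r1) expnD leq_mul2r leq_pow2r ?orbT ?deg_lt.
Qed.

(** Chains [hubs], [rigid] and [iso_Hmatch]. The hypothesis on sets [A] isolates what depends on the
    parity of [l] and on [s]. *)
Lemma stability l s r k : 0 < k -> 1 < r -> 1 < l <= k.*2 + 3 ->
  exists N, forall n q (g : graph n), N <= n -> k + q <= n -> ~~ odd q ->
    simple g -> Ffree (broom l s) g -> e_r r (Hmatch k q n) <= e_r r g ->
    (forall A : {set 'I_n}, let W := cnb g A in
       #|A| = k -> k.*2.+3 + s <= #|W| ->
       #|[set w in W | [exists y in W, adj g w y]]| <= q.+1 /\
       (forall w y z, w \in W -> y \notin A -> z \notin A ->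
          adj g w y -> adj g y z -> z = w)) ->
    isomorphic g (Hmatch k q n).
Proof.
move=> k0 r1 lk; have l1 : 1 < l by case/andP: lk.
pose c := k.+1 ^ r - k ^ r; pose E := 2 * k + 4 * (l + s) + c.+1.
have [|N0 HN] := @hubs l s k (4 * k.+1 * E) lk; first by rewrite /E; nia.
exists (N0 + (E * k).*2 + 2 + (k.*2.+3 + s).*2) => n q g nN kq q2 sg fr le H.
have eH := e_r_Hmatch (ltnW r1) kq q2; have le' := leq_trans eH le.
have [||A [cA hA]] := HN n g _ sg fr _; first by clear -nN; lia.
  apply: sum_sqr_deg r1 _ sg _; first by clear -nN; lia.
  by apply: leq_trans le'; rewrite -addnA leq_addr.
(* The total deficit of the hubs is at most [n / 2], so at least half of all vertices are common
   neighbours. *)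
have cW : k.*2.+3 + s <= #|cnb g A|.
  have cw := card_cnb g A.
  have : 4 * k.+1 * E * \sum_(a in A) (n - deg g a) <= k * n.
    by rewrite -[X in _ <= X * _]cA -sum_nat_const big_distrr; apply: leq_sum.
  set Y := \sum_(a in A) _ in cw *; set C := #|_| in cw *.
  move=> hY; have : 2 * Y <= n.
    rewrite -(leq_pmul2l k0); apply: leq_trans hY.
    by rewrite mulnA leq_mul2r; apply/orP; right; rewrite /E; clear; nia.
  by move: cw nN; clear; clearbody Y C; lia.
have [cQ P3] := H A cA cW.
have [|WA dA qQ] := @rigid l s r k q n g A k0 r1 l1 sg fr cA hA _ P3 le' cQ.
  by rewrite -/c -/E; clear -nN; lia.
have WE : cnb g A = ~: A.
  apply/eqP; rewrite eqEsubset WA andbT; apply/subsetP => w wW.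
  by rewrite in_setC; exact: cnb_notin wW.
rewrite WE in cQ P3 qQ.
have [||] := @iso_Hmatch n k g A sg cA.
- move=> a x aA xa; have := card_nonnb a sg; rewrite dA // subnn => /cards0_eq.
  by move/setP/(_ x); rewrite in_setC in_setU1 in_nb (negbTE xa) in_set0 /= => /negbFE.
- by move=> x y z xA yA zA; apply: P3 => //; rewrite -in_setC.
set Q := [set x in _ | _] in cQ qQ * => oQ.
(* Both numbers are even and [q <= #|Q| <= q.+1]. *)
suff -> : #|Q| = q by [].
by move: #|Q| oQ q2 cQ qQ => t; clear; lia.
Qed.

Theorem theorem1p1 (l s r : nat) :
  4 <= l -> 2 <= r ->
  exists N : nat, forall n : nat, N <= n ->
    let k := (l - 2)./2 in
    [/\ ~~ odd l -> unique_extremal n r (broom l s) (Hkn k n),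
        odd l -> (7 <= l \/ (l = 5 /\ s = 0)) ->
          unique_extremal n r (broom l s) (Hstar k n)
      & l = 5 -> 0 < s -> unique_extremal n r (broom l s) (Fn n)].
Proof.
move=> l4 r2; set k := (l - 2)./2.
have k0 : 0 < k by rewrite /k; lia.
have lk : 1 < l <= k.*2 + 3 by rewrite /k; lia.
have [N HN] := stability s k0 r2 lk.
exists (N + k + 3) => n nN; have {HN} HN := HN n.
have Nn : N <= n by lia.
have kn : k + 2 <= n by lia.
split=> [ol|ol ls|l5 s0].
- have lE : l = k.*2.+2 by rewrite /k; lia.
  rewrite HknE; clearbody k; subst l.
  apply: unique_extremalI => [||G sG fG leG]; [exact: simple_Hmatch|exact: Hmatch0_free|].
  apply: HN => // [|A W cA cW]; first by rewrite addn0 (leq_trans _ kn) ?leq_addr.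
  have noe w y := @no_edge_at_cnb k s n G A w y sG fG k0 cA (ltnW cW).
  split=> [|w y z wW yA _ wy]; last by have := noe w y wW yA; rewrite wy.
  rewrite (_ : [set w in W | _] = set0) ?cards0 //; apply/setP => w.
  rewrite in_set0 inE; apply/negP => /andP[wW /exists_inP[y yW]].
  by apply/negP/noe => //; exact: cnb_notin yW.
- have lE : l = k.*2.+3 by rewrite /k; lia.
  have ks : 1 < k \/ s = 0 by case: ls => [|[]]; [left|right]; lia.
  rewrite HstarE; clearbody k; clear ls; subst l.
  apply: unique_extremalI => [||G sG fG leG]; [exact: simple_Hmatch|exact: Hmatch2_free|].
  apply: HN => // A W cA cW; split; first exact/leqW/(matched_le2 sG fG k0 ks cA cW).
  by move=> w y z; exact: no_path3_at_cnb sG fG k0 cA cW.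
have kE : k = 1 by rewrite /k l5.
clearbody k; subst k l.
rewrite FnE; apply: unique_extremalI => [||G sG fG leG].
- exact: simple_Hmatch.
- by rewrite -FnE; exact: Fn_free.
apply: HN => //; [by lia|by rewrite odd_double|move=> A W cA cW; split].
  (* Here [q.+1] is at least [n - 1], the number of vertices other than the hub, so the bound on
     matched vertices is automatic. *)
  apply: leq_trans (_ : #|~: A| <= _).
    apply/subset_leq_card/subsetP => w; rewrite inE => /andP[wW _].
    by rewrite in_setC; exact: cnb_notin wW.
  by rewrite cardsCs setCK card_ord cA; lia.
by move=> w y z; exact: (@no_path3_at_cnb 1 s).
Qed.
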